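(* Fix $n\ge 2$, a number $h(n)\in\mathbb{C}$, and a function $e:\mathbb{N}\times\mathbb{N}\to\mathbb{C}$ (with $0\in\mathbb{N}$) such that $e(i,j)=0$ for $i>j$, and $e(i,i)=1$, $e(i,i+1)>0$ for all $i$. Let $P_n$ be a probability measure on all subsets of $[n-1]=\{1,\dots,n-1\}$ given, for every $S=\{s_1<s_2<\dots<s_k\}\subseteq[n-1]$, by $$P_n(S)=h(n)\det\left[e(s_i,s_{j+1})\right]_{i,j=0}^k,\qquad s_0=0,\ s_{k+1}=n.$$ Then $P_n$ is a determinantal, one-dependent process with correlation functions $$\rho(A)=P_n\{S:S\supseteq A\}=\det\left[K(a_i,a_j)\right]_{i,j=1}^m\qquad\text{for }A=\{a_1,a_2,\dots,a_m\}\subseteq[n-1],$$ with correlation kernel $$K(x,y)=\delta_{x,y}+(E^{-1})_{x,y+1},\qquad 1\le x,y\le n-1,$$ where $E$ is the $n\times n$ upper triangular matrix $E=[e(i-1,j)]_{i,j=1}^n$. In addition, $h(n)=(\det E)^{-1}=(e(0,1)e(1,2)\cdots e(n-1,n))^{-1}$.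
   Context: A point process on $[n-1]$ is a probability measure on the subsets of $[n-1]$; its correlation function is $\rho(A)=P\{S:S\supseteq A\}$. It is one-dependent if $\rho(X\cup Y)=\rho(X)\rho(Y)$ whenever $X,Y\subseteq[n-1]$ satisfy $|x-y|\ge2$ for all $x\in X,y\in Y$. It is determinantal with correlation kernel $K$ if $\rho(A)=\det(K(x,y))_{x,y\in A}$ for all $A\subseteq[n-1]$.
   Formalization: The matrix E is taken to have entries e(i-1,j) for i ≤ j and 0 below the diagonal; the literal [e(i-1,j)] has subdiagonal entries e(j,j)=1, so it is not upper triangular and h(n)=(det E)^{-1} would fail. *)

(* Defs.v *)
From mathcomp Require Import all_boot all_order all_algebra.
From mathcomp Require Import reals complex.

Set Implicit Arguments.
Unset Strict Implicit.
Unset Printing Implicit Defensive.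

Import Order.TTheory GRing.Theory Num.Theory.
Local Open Scope ring_scope.
Local Open Scope complex_scope.

(* The ground set {1, ..., n-1} is encoded by 'I_n.-1: the ordinal i, with    *)
(* values 0, ..., n-2, stands for the site i.+1.                              *)

Definition site n (i : 'I_n.-1) : nat := i.+1.

Section PointProcess.
Variables (R : realType) (n : nat).
Implicit Types (P : {set 'I_n.-1} -> R) (A S X Y : {set 'I_n.-1}).

Definition point_process P : Prop :=
  (forall S, 0 <= P S) /\ \sum_S P S = 1.

Definition correlation P A : R := \sum_(S : {set 'I_n.-1} | A \subset S) P S.

Definition separated X Y : Prop :=
  forall x y, x \in X -> y \in Y -> (2 <= `|site x - site y|)%N.

Definition one_dependent P : Prop :=
  forall X Y, separated X Y ->
    correlation P (X :|: Y) = correlation P X * correlation P Y.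

Definition determinantal P (K : 'I_n.-1 -> 'I_n.-1 -> R[i]) : Prop :=
  forall A, (correlation P A)%:C =
    \det (\matrix_(i < #|A|, j < #|A|) K (enum_val i) (enum_val j)).

End PointProcess.

(* s_0 = 0 < s_1 < ... < s_k < s_(k+1) = n; the enumeration of a set of       *)
(* ordinals is increasing.                                                    *)
Definition points n (S : {set 'I_n.-1}) : seq nat :=
  0%N :: rcons [seq site i | i <- enum S] n.

Section Kernel.
Variables (R : realType) (n : nat) (e : nat -> nat -> R[i]).

Definition weight_mx (S : {set 'I_n.-1}) : 'M[R[i]]_(#|S|.+1) :=
  \matrix_(i, j) e (nth 0%N (points S) i) (nth 0%N (points S) j.+1).

(* With rows and columns numbered from 1, the (i,j) entry is e(i-1,j) for     *)
(* i <= j.  The part below the diagonal must be cleared explicitly: on the    *)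
(* first subdiagonal e(i-1,j) is e(j,j) = 1, not 0.                           *)
Definition Emx : 'M[R[i]]_n :=
  \matrix_(i, j) (if (i <= j)%N then e i j.+1 else 0).

Lemma succ_site_proof (y : 'I_n.-1) : (y.+1 < n)%N.
Proof. by rewrite -ltn_predRL. Qed.

(* Numbered from 0, row x and column y + 1 of Emx are the positions           *)
(* (site x) - 1 = x and (site y + 1) - 1 = y.+1.                              *)
Definition kernel (x y : 'I_n.-1) : R[i] :=
  (x == y)%:R +
  invmx Emx (widen_ord (leq_pred n) x) (Ordinal (succ_site_proof y)).

End Kernel.

(* Main.v *)
(* Write D_A for the matrix with ones at the subdiagonal positions (s, s-1),
   s in A, and G for the Hessenberg matrix [e(i-1,j)], whose subdiagonal entries
   are all 1, so that E + D_A arises from G by clearing the subdiagonal outside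
   A.  Expanding the rows of E + D_A indexed by the complement of A by
   multilinearity gives
     det (E + D_A) = sum_{S >= A} det [e(s_i, s_{j+1})],
   hence h det E = 1 (A empty) and rho(A) = det (1 + D_A E^-1).  By Sylvester's
   identity det (1 + U V) = det (1 + V U) the latter is the minor of K on A.

   If every point of X is at least 2 above every point of Y, then
   D_X E^-1 D_Y = 0 because E^-1 is upper triangular, so
   (1 + D_X E^-1) (1 + D_Y E^-1) = 1 + D_(X u Y) E^-1 and rho is multiplicative.
   Interleaved separated sets are handled by peeling off the topmost cluster. *)

Require Import Defs.
From mathcomp Require Import all_boot all_order all_algebra all_fingroup.
From mathcomp Require Import reals complex zify.
Import Order.TTheory GRing.Theory Num.Theory.
Local Open Scope ring_scope.
Local Open Scope complex_scope.

(** * Determinant identities and triangular inverses *)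

(** Two block triangular factorizations of one matrix, with blocks 1, [U], [- V], 1, are
    compared. *)
Lemma det_1DM (R : comNzRingType) (m n : nat) (U : 'M[R]_(m, n))
    (V : 'M[R]_(n, m)) :
  \det (1%:M + U *m V) = \det (1%:M + V *m U).
Proof.
have eq1 : block_mx 1%:M U 0 1%:M *m block_mx (1%:M + U *m V) 0 (- V) 1%:M
    = block_mx 1%:M U (- V) 1%:M.
  by rewrite mulmx_block !(mul1mx, mulmx1, mul0mx, mulmx0, mulmxN, add0r) addrK.
have eq2 : block_mx 1%:M 0 (- V) 1%:M *m block_mx 1%:M U 0 (1%:M + V *m U)
    = block_mx 1%:M U (- V) 1%:M.
  rewrite mulmx_block !(mul1mx, mulmx1, mul0mx, mulmx0, mulNmx, addr0).
  by rewrite addrC addrK.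
have := congr1 determinant (etrans eq1 (esym eq2)).
by rewrite !det_mulmx !(det_ublock, det_lblock) !det1 !(mul1r, mulr1).
Qed.

(** With [U] made of the identity columns picked by [f] and [V] of the rows of M - 1 picked by [f],
    the minor is 1 + V U and the full-size matrix is 1 + U V. *)
Lemma det_principal_minor (R : comNzRingType) (k n : nat) (f : 'I_k -> 'I_n)
    (M : 'M[R]_n) :
  injective f ->
  \det (mxsub f f M) =
  \det (\matrix_(i, j) if i \in codom f then M i j else (i == j)%:R).
Proof.
move=> f_inj.
pose U : 'M[R]_(n, k) := \matrix_(i, l) (i == f l)%:R.
pose V : 'M[R]_(k, n) := rowsub f (M - 1%:M).
have -> : mxsub f f M = 1%:M + V *m U.
  apply/matrixP=> i j; rewrite !mxE (bigD1 (f j)) //= big1 => [|l /negPf ne].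
    by rewrite !mxE eqxx mulr1 addr0 (inj_eq f_inj) addrC subrK.
  by rewrite !mxE ne mulr0.
rewrite -det_1DM; congr (\det _); apply/matrixP=> i j; rewrite !mxE.
case: ifP => [/codomP[l ->]|fi].
  rewrite (bigD1 l) //= big1 => [|l' /negPf ne].
    by rewrite !mxE eqxx mul1r addr0 addrC subrK.
  by rewrite !mxE (inj_eq f_inj) eq_sym ne mul0r.
rewrite big1 ?addr0 // => l _; rewrite !mxE.
by case: eqP fi => [->|_ _]; rewrite ?codom_f ?mul0r.
Qed.

(** Multilinearity in the lower rows, by distributing each product of the Leibniz formula; [S]
    collects the rows taken from [M]. *)
Lemma det_col_mxD (R : comNzRingType) (m : nat) (r : 'rV[R]_(1 + m))
    (M N : 'M[R]_(m, 1 + m)) :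
  \det (col_mx r (M + N)) =
  \sum_(S : {set 'I_m})
    \det (col_mx r (\matrix_(i, j) if i \in S then M i j else N i j)).
Proof.
rewrite exchange_big /=; apply: eq_bigr => s _.
rewrite big_split_ord /=.
under [\prod_(i < m) _]eq_bigr => i _ do rewrite col_mxEd mxE.
rewrite bigA_distr mulrA [LHS]mulr_sumr; apply: eq_big => [S|S _].
  by rewrite inE.
rewrite -mulrA; congr (_ * _).
rewrite big_split_ord /=; congr (_ * _).
  by apply: eq_bigr => i _; rewrite !col_mxEu.
by apply: eq_bigr => i _; rewrite col_mxEd mxE.
Qed.

(** The permutation is a cycle through all n + 1 columns, hence the sign. *)
Lemma det_last_col_first (R : comNzRingType) (n : nat) (M : 'M[R]_n.+1) :
  \det (col_perm (lift_perm ord0 ord_max 1) M) = (-1) ^+ n * \det M.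
Proof.
rewrite col_permE det_mulmx det_perm odd_permV odd_lift_perm odd_perm1 /=.
by rewrite addbF signr_odd mulrC.
Qed.

(** Induction from the last row upwards: once the rows below row i are known, E E^-1 = 1 at (i, j)
    with j < i reads E_ii (E^-1)_ij = 0. *)
Lemma upper_invmx (F : fieldType) (n : nat) (E : 'M[F]_n) :
  (forall i j : 'I_n, (j < i)%N -> E i j = 0) ->
  (forall i, E i i != 0) ->
  forall i j : 'I_n, (j < i)%N -> invmx E i j = 0.
Proof.
move=> E_up E_diag.
have E_unit : E \in unitmx.
  rewrite unitmxE -det_tr det_trig.
    by rewrite unitfE; apply/prodf_neq0 => i _; rewrite mxE.
  by apply/is_trig_mxP => i j ij; rewrite mxE E_up.
move=> i j; move: {2}(n - i)%N (leqnn (n - i)) => d.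
elim: d i => [|d IH] i.
  by rewrite leqNgt subn_gt0 ltn_ord.
move=> le_d ji; have := congr1 (fun A : 'M_n => A i j) (mulmxV E_unit).
rewrite !mxE (bigD1 i) //= big1 => [|l ne_li].
  rewrite addr0 -val_eqE /= gtn_eqF // => /eqP.
  by rewrite mulf_eq0 (negPf (E_diag i)) => /eqP.
case: (ltngtP l i) ne_li => [li|il|/val_inj ->]; last by rewrite eqxx.
  by rewrite E_up ?mul0r.
move=> _; rewrite IH ?mulr0 ?(ltn_trans ji) //.
by rewrite -ltnS (leq_trans _ le_d) // ltn_sub2l // ltn_ord.
Qed.

(** * Subdiagonal matrices D_A *)

(** This is D_A: the ordinal s stands for site s + 1, so its one sits in row s + 1, column s,
    counted from 0. The size [1 + m] lets [col_mx] split off the top row, which belongs to no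
    site. *)
Definition subdiag (R : pzRingType) {m : nat} (A : {set 'I_m}) :
  'M[R]_(1 + m) :=
  \sum_(s in A) delta_mx (rshift 1 s) (widen_ord (leqnSn m) s).

Lemma subdiag_col_mx (R : pzRingType) (m : nat) (A : {set 'I_m}) :
  subdiag R A =
  col_mx 0 (\matrix_(s, j) ((s \in A) && (j == s :> nat))%:R).
Proof.
apply/matrixP=> i j; rewrite /subdiag summxE.
case: (split_ordP i) => [{}i|t] ->; rewrite ?col_mxEu ?col_mxEd !mxE.
  by rewrite big1 // => s _; rewrite mxE eq_lrshift.
case tA: (t \in A) => /=.
  rewrite (bigD1 t) //= big1 => [|s /andP[_ /negPf ne]].
    by rewrite mxE eqxx addr0.
  by rewrite mxE eq_rshift eq_sym ne.
rewrite big1 // => s sA; rewrite mxE eq_rshift.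
by case: eqP sA => [<-|//]; rewrite tA.
Qed.

(** D_A factors through #|A| dimensions; after Sylvester's identity the left factor picks columns s
    + 1 and the right one rows s, whence the shift in the kernel. *)
Lemma det_subdiag (R : comNzRingType) (m : nat) (M : 'M[R]_(1 + m))
    (A : {set 'I_m}) :
  \det (1%:M + subdiag R A *m M) =
  \det (\matrix_(k < #|A|, l < #|A|)
    ((k == l)%:R
       + M (widen_ord (leqnSn m) (enum_val k)) (rshift 1 (enum_val l)))).
Proof.
pose U : 'M[R]_(1 + m, #|A|) := \matrix_(i, k) (i == rshift 1 (enum_val k))%:R.
pose f (k : 'I_#|A|) := widen_ord (leqnSn m) (enum_val k).
have -> : subdiag R A = U *m rowsub f 1%:M.
  rewrite /subdiag big_enum_val; apply/matrixP=> i j.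
  rewrite summxE !mxE; apply: eq_bigr => k _.
  by rewrite !mxE -natrM mulnb [j == _]eq_sym.
rewrite -mulmxA -rowsubE det_1DM; congr (\det _).
apply/matrixP=> k l; rewrite !mxE.
congr (_ + _); rewrite (bigD1 (rshift 1 (enum_val l))) //=.
rewrite big1 => [|i /negPf ne].
  by rewrite !mxE eqxx mulr1 addr0.
by rewrite !mxE ne mulr0.
Qed.

Lemma subdiagU (R : pzRingType) (m : nat) (X Y : {set 'I_m}) :
  [disjoint X & Y] -> subdiag R (X :|: Y) = subdiag R X + subdiag R Y.
Proof.
move=> dXY; rewrite /subdiag -bigU //; apply: eq_bigl => s.
by rewrite !inE.
Qed.

Lemma det_subdiagU (R : comNzRingType) (m : nat) (M : 'M[R]_(1 + m))
    (X Y : {set 'I_m}) :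
  [disjoint X & Y] ->
  (forall x y, x \in X -> y \in Y ->
     M (widen_ord (leqnSn m) x) (rshift 1 y) = 0) ->
  \det (1%:M + subdiag R (X :|: Y) *m M) =
  \det (1%:M + subdiag R X *m M) * \det (1%:M + subdiag R Y *m M).
Proof.
move=> dXY M0; rewrite -det_mulmx; congr (\det _).
(* Each term of the double sum is an elementary matrix scaled by the entry of [M] at (x, y + 1). *)
have XMY : subdiag R X *m M *m subdiag R Y = 0.
  rewrite /subdiag !mulmx_suml big1 // => x xX.
  rewrite mulmx_sumr big1 // => y yY; apply/matrixP=> i j; rewrite !mxE.
  rewrite big1 // => k _; rewrite !mxE.
  case: (k =P rshift 1 y) => [->|_]; last by rewrite mulr0.
  rewrite big1 ?mul0r // => l _; rewrite mxE.
  case: (l =P widen_ord _ x) => [->|_]; last by rewrite andbF mul0r.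
  by rewrite M0 ?mulr0.
rewrite subdiagU // mulmxDl mulmxDr mulmx1 mulmxDl mul1mx.
by rewrite !mulmxA XMY mul0mx addr0 addrA.
Qed.

(** * Weights as Hessenberg determinants *)

Lemma nth_points_succ (m : nat) (S : {set 'I_m.+1.-1}) (k : 'I_#|S|) :
  nth 0%N (points S) k.+1 = (enum_val k).+1.
Proof.
rewrite /= nth_rcons size_map -cardE ltn_ord.
rewrite (nth_map (enum_val k)) -?cardE ?ltn_ord // /site.
by rewrite -(enum_val_nth (enum_val k) k).
Qed.

Lemma nth_points_last (m : nat) (S : {set 'I_m.+1.-1}) :
  nth 0%N (points S) #|S|.+1 = m.+1.
Proof. by rewrite /= nth_rcons size_map -cardE ltnn eqxx. Qed.

(** Together with [hess_rows] this is the Hessenberg matrix G, cut so that each lower row belongs to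
    a site. *)
Definition hess_top (R : pzRingType) {m : nat} (e : nat -> nat -> R) :
  'rV[R]_(1 + m) := \row_j e 0 j.+1.

Definition hess_rows (R : pzRingType) {m : nat} (e : nat -> nat -> R) :
  'M[R]_(m, 1 + m) := \matrix_(t, j) e t.+1 j.+1.

(** The subdiagonal of G is e(i,i) = 1; [Emx] clears it and D_A restores it on [A], so only sites
    outside [A] get a correction. The lower block is left as a sum, ready for row expansion. *)
Lemma Emx_subdiag (R : realType) (m : nat) (e : nat -> nat -> R[i])
    (A : {set 'I_m}) :
  (forall i j : nat, (j < i)%N -> e i j = 0) ->
  (forall i : nat, e i i = 1) ->
  Emx (1 + m) e + subdiag R[i] A =
  col_mx (hess_top R[i] e)
    (hess_rows R[i] e
     + \matrix_(t, j) - ((t \notin A) && (j == t :> nat))%:R).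
Proof.
move=> e_gt e_diag; apply/matrixP=> i j; rewrite subdiag_col_mx.
case: (@split_ordP 1 m i) => [{}i|t] ->;
  rewrite mxE !(col_mxEu, col_mxEd) !mxE.
  by rewrite ord1 addr0.
rewrite /= add1n; case: (ltngtP t j) => [tj|jt|tj] /=.
- by rewrite !andbF subr0 addr0.
- by rewrite !andbF subr0 addr0 e_gt.
- by rewrite !andbT tj e_diag; case: (t \in A); rewrite /= ?subr0 ?subrr ?add0r.
Qed.

(* The minor [e(s_i, s_{j+1})] becomes a principal minor once the last column is
   moved to the front; det_principal_minor then completes it to full size.  All
   the signs involved cancel. *)
Lemma det_weight_mx (R : realType) (m : nat) (e : nat -> nat -> R[i])
    (S : {set 'I_m}) :
  \det (@weight_mx R m.+1 e S) =
  \det (col_mx (hess_top R[i] e)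
    (\matrix_(t, j) if t \in S then hess_rows R[i] e t j
                    else - (j == t :> nat)%:R)).
Proof.
set B := col_mx _ _.
pose f (i : 'I_(1 + #|S|)) : 'I_(1 + m) :=
  match split i with inl i0 => lshift m i0 | inr k => rshift 1 (enum_val k) end.
have f_inj : injective f.
  move=> i j; rewrite /f.
  case: (split_ordP i) => [i0|k] ->; case: (split_ordP j) => [j0|l] -> //.
  - by move/eqP; rewrite eq_lshift => /eqP ->.
  - by move/eqP; rewrite eq_lrshift.
  - by move/eqP; rewrite eq_rlshift.
  - by move/eqP; rewrite eq_rshift => /eqP /enum_val_inj ->.
(* Column 0 stands for the endpoint n = m + 1, so rows and columns share the index set {0, ..., m}
   and the weight becomes the principal minor on 0 and [S]. *)
pose G : 'M[R[i]]_(1 + m) :=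
  \matrix_(i, j) e i (if j == 0 :> nat then m.+1 else j).
have cW : \det (mxsub f f G) = (-1) ^+ #|S| * \det (@weight_mx R m.+1 e S).
  rewrite -det_last_col_first; congr (\det _); apply/matrixP=> i j.
  rewrite !mxE; congr e.
    rewrite /f; case: (split_ordP i) => [i0|k] ->; first by rewrite ord1.
    by rewrite nth_points_succ.
  rewrite /f; case: (split_ordP j) => [j0|k] ->.
    rewrite ord1 (_ : lshift #|S| (ord0 : 'I_1) = ord0 :> 'I_#|S|.+1).
      by rewrite lift_perm_id [RHS]nth_points_last.
    exact: val_inj.
  rewrite (_ : rshift 1 k = lift ord0 k :> 'I_#|S|.+1); last exact: val_inj.
  by rewrite lift_perm_lift perm1 lift_max nth_points_succ.
pose c (j : 'I_(1 + m)) : 'I_(1 + m) := lift_perm (ord0 : 'I_m.+1) ord_max 1 j.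
have cE j : (c j).+1 = if j == 0 :> nat then m.+1 else j.
  rewrite /c; case: (split_ordP j) => [j0|k] ->.
    rewrite ord1 (_ : lshift m (ord0 : 'I_1) = ord0 :> 'I_m.+1).
      by rewrite lift_perm_id.
    exact: val_inj.
  rewrite (_ : rshift 1 k = lift ord0 k :> 'I_m.+1); last exact: val_inj.
  by rewrite lift_perm_lift perm1 lift_max.
(* The negation turns the -1 in the rows outside [S] into the identity rows of the completed
   minor. *)
have cB : \det (\matrix_(i, j) - B i (c j)) = \det (mxsub f f (- G)).
  rewrite det_principal_minor //; congr (\det _); apply/matrixP=> i j.
  have fE k : f (rshift 1 k) = rshift 1 (enum_val k).
    by rewrite /f (unsplitK (inr k)).
  have f0 (i0 : 'I_1) : f (lshift #|S| i0) = lshift m i0.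
    by rewrite /f (unsplitK (inl i0)).
  rewrite mxE [RHS]mxE; case: (split_ordP i) => [i0|t] ->.
    by rewrite -f0 codom_f f0 col_mxEu !mxE cE ord1.
  rewrite col_mxEd !mxE; case: (boolP (t \in S)) => tS.
    have -> : rshift 1 t = f (rshift 1 (enum_rank_in tS t)).
      by rewrite fE enum_rankK_in.
    by rewrite codom_f fE enum_rankK_in // cE.
  rewrite opprK ifF; last first.
    apply/negP => /codomP[k]; case: (split_ordP k) => [k0|l] ->.
      by rewrite f0 => /eqP; rewrite eq_rlshift.
    rewrite fE => /rshift_inj tl.
    by rewrite tl enum_valP in tS.
  rewrite -eqSS cE -val_eqE /= (add1n t) [t.+1 == _]eq_sym.
  by case: (j =P 0%N :> nat) => // ->; rewrite eqSS gtn_eqF.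
have detN k (M : 'M[R[i]]_k) : \det (- M) = (-1) ^+ k * \det M.
  by rewrite -scaleN1r detZ.
have GN : mxsub f f (- G) = - mxsub f f G by apply/matrixP=> i j; rewrite !mxE.
rewrite GN detN cW in cB.
have BN : \matrix_(i, j) - B i (c j)
    = - col_perm (lift_perm (ord0 : 'I_m.+1) ord_max 1) B.
  by apply/matrixP=> i j; rewrite !mxE.
rewrite BN detN (@det_last_col_first _ m) !mulrA -!exprD in cB.
(* Each side carries one sign from the negation and one from the column cycle: exponent 2k + 1, with
   k = m or k = #|S|. *)
have odd1 k : (-1) ^+ (1 + k + k) = -1 :> R[i].
  by rewrite -signr_odd -addnA addnn /= odd_double.
by move: cB; rewrite !odd1 !mulN1r => /oppr_inj.
Qed.

(** * Interleaved separated sets *)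

(** Induction on #|X| + #|Y|. If max X > max Y, the part [C] of [X] above max Y is cut off, and
    induction applies to the rest of [X] and [Y]. *)
Lemma separated_mul (V : comPzSemiRingType) (m : nat) (F : {set 'I_m} -> V) :
  F set0 = 1 ->
  (forall X Y : {set 'I_m},
     (forall x y, x \in X -> y \in Y -> (y.+1 < x)%N) ->
     F (X :|: Y) = F X * F Y) ->
  forall X Y : {set 'I_m},
    (forall x y, x \in X -> y \in Y -> (y.+1 < x)%N || (x.+1 < y)%N) ->
    F (X :|: Y) = F X * F Y.
Proof.
move=> F0 Fcut X Y; move: {2}(#|X| + #|Y|)%N (leqnn (#|X| + #|Y|)) => d.
elim: d X Y => [|d IH] X Y.
  rewrite leqn0 addn_eq0 !cards_eq0 => /andP[/eqP -> _] _.
  by rewrite set0U F0 mul1r.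
have [->|[x0 x0X]] := set_0Vmem X; first by rewrite set0U F0 mul1r.
have [->|[y0 y0Y]] := set_0Vmem Y; first by rewrite setU0 F0 mulr1.
pose mx := [arg max_(i > x0 in X) (i : nat)].
pose my := [arg max_(i > y0 in Y) (i : nat)].
have [mxX mx_max] : mx \in X /\ forall x, x \in X -> (x <= mx)%N.
  by rewrite /mx; case: arg_maxnP => // i iX i_max; split.
have [myY my_max] : my \in Y /\ forall y, y \in Y -> (y <= my)%N.
  by rewrite /my; case: arg_maxnP => // i iY i_max; split.
move: mx my mxX mx_max myY my_max => mx my {x0 x0X y0 y0Y}.
wlog lt_my_mx : X Y mx my / (my < mx)%N => [hw|].
  move=> mxX mx_max myY my_max le_d sep.
  case/orP: (sep _ _ mxX myY) => lt_m.
    by apply: (hw X Y mx my) => //; apply: ltnW.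
  rewrite setUC mulrC; apply: (hw Y X my mx) => //; first exact: ltnW.
    by rewrite addnC.
  by move=> y x yY xX; rewrite orbC sep.
move=> mxX _ myY my_max le_d sep.
pose C := [set x in X | (my < x)%N]; pose X' := X :\: C.
have XE : X = C :|: X'.
  apply/setP=> x; rewrite !inE; case: (x \in X).
    by rewrite /= andbT orbN.
  by rewrite andbF.
(* The point [my] separates [C] from the rest of [X], with a gap on both sides. *)
have X'P x : x \in X' -> x \in X /\ (x.+1 < my)%N.
  rewrite !inE => /andP[nC xX]; split=> //; move: nC (sep _ _ xX myY).
  rewrite xX /= -leqNgt => le_x /orP[/ltnW lt|//].
  by move: (leq_trans lt le_x); rewrite ltnn.
have CP x : x \in C -> x \in X /\ (my.+1 < x)%N.
  rewrite inE => /andP[xX lt_x]; split=> //; case/orP: (sep _ _ xX myY) => //.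
  by move=> /ltnW/ltnW le_x; rewrite ltnNge le_x in lt_x.
have C_X' : F X = F C * F X'.
  rewrite {1}XE Fcut // => x y /CP[_ lt_x] /X'P[_ lt_y].
  by apply: leq_trans lt_x; rewrite !ltnS ltnW // ltnW.
rewrite {1}XE -setUA Fcut ?IH ?C_X' ?mulrA //.
- rewrite -ltnS (leq_trans _ le_d) // ltn_add2r proper_card //.
  rewrite properE subsetDl; apply/subsetPn; exists mx => //.
  by rewrite !inE mxX lt_my_mx.
- by move=> x y /X'P[xX _]; exact: sep.
- move=> x y /CP[_ lt_x]; rewrite in_setU => yX'Y; apply: leq_trans lt_x.
  rewrite !ltnS; case/orP: yX'Y => [/X'P[_ lt_y]|/my_max //].
  by rewrite ltnW // ltnW.
Qed.

Lemma separated_gap (n : nat) (X Y : {set 'I_n.-1}) :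
  separated X Y ->
  forall x y, x \in X -> y \in Y -> (y.+1 < x)%N || (x.+1 < y)%N.
Proof. by move=> sep x y xX yY; move: (sep x y xX yY); rewrite /site; lia. Qed.

(** * Correlation functions and the theorem *)

Lemma det_Emx_subdiag (R : realType) (m : nat) (e : nat -> nat -> R[i])
    (e_gt : forall i j : nat, (j < i)%N -> e i j = 0)
    (e_diag : forall i : nat, e i i = 1) (A : {set 'I_m}) :
  \det (Emx (1 + m) e + subdiag R[i] A) =
  \sum_(S : {set 'I_m} | A \subset S) \det (@weight_mx R m.+1 e S).
Proof.
rewrite Emx_subdiag // det_col_mxD.
rewrite (bigID (fun S : {set 'I_m} => A \subset S)) /=.
rewrite [X in _ + X]big1 ?addr0 => [|S /subsetPn[t tA tS]].
  apply: eq_bigr => S /subsetP AS; rewrite det_weight_mx.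
  congr (\det (col_mx _ _)); apply/matrixP=> t j; rewrite !mxE.
  case: (boolP (t \in S)) => // tS.
  by rewrite (contra (AS t) tS).
(* A site [t] in [A] but not in [S] leaves a zero row. *)
rewrite (expand_det_row _ (rshift 1 t)) big1 // => j _.
by rewrite col_mxEd !mxE (negPf tS) tA oppr0 mul0r.
Qed.

Lemma det_Emx (R : realType) (n : nat) (e : nat -> nat -> R[i]) :
  \det (Emx n e) = \prod_(i < n) e i i.+1.
Proof.
rewrite -det_tr det_trig; first by apply: eq_bigr => i _; rewrite !mxE leqnn.
by apply/is_trig_mxP => i j ij; rewrite !mxE leqNgt ij.
Qed.

Theorem theorem7p5 (R : realType) (n : nat) (hn : (2 <= n)%N) (h : R[i])
    (e : nat -> nat -> R[i])
    (e_gt : forall i j : nat, (j < i)%N -> e i j = 0)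
    (e_diag : forall i : nat, e i i = 1)
    (e_succ : forall i : nat, 0 < e i i.+1)
    (P : {set 'I_n.-1} -> R)
    (P_process : point_process P)
    (P_weight : forall S : {set 'I_n.-1},
       (P S)%:C = h * \det (weight_mx e S)) :
  determinantal P (kernel e) /\
  one_dependent P /\
  h = (\det (Emx n e))^-1 /\
  (\det (Emx n e))^-1 = (\prod_(i < n) e i i.+1)^-1.
Proof.
case: n hn P P_process P_weight => [//|m] _ P [_ P1] P_weight.
have detE_neq0 : \det (Emx m.+1 e) != 0.
  by rewrite det_Emx; apply/prodf_neq0 => i _; rewrite gt_eqF.
have corr A : (correlation P A)%:C = h * \det (Emx (1 + m) e + subdiag R[i] A).
  rewrite /correlation rmorph_sum det_Emx_subdiag // mulr_sumr.
  by apply: eq_bigr => S _; exact: P_weight.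
have hE : h = (\det (Emx m.+1 e))^-1.
  apply: (mulIf detE_neq0); rewrite mulVf //.
  (* For empty [A] the correlation is the total mass 1, and D_A = 0. *)
  have := corr set0; rewrite /subdiag big_set0 addr0 => <-.
  by rewrite /correlation (eq_bigl predT) ?P1 // => S; rewrite sub0set.
pose M : 'M[R[i]]_(1 + m) := invmx (Emx (1 + m) e).
have E_unit : Emx (1 + m) e \in unitmx by rewrite unitmxE unitfE.
have corrM A : (correlation P A)%:C = \det (1%:M + subdiag R[i] A *m M).
  have -> : 1%:M + subdiag R[i] A *m M = (Emx (1 + m) e + subdiag R[i] A) *m M.
    by rewrite mulmxDl mulmxV.
  by rewrite det_mulmx det_inv mulrC corr hE.
split; last (split; last by rewrite -det_Emx).
  move=> A; rewrite corrM det_subdiag; congr (\det _).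
  apply/matrixP=> k l; rewrite !mxE /kernel (inj_eq enum_val_inj).
  by congr (_ + M _ _); apply: val_inj.
move=> X Y sep; apply: complexI; rewrite rmorphM /= !corrM.
apply: (@separated_mul _ _ (fun A => \det (1%:M + subdiag R[i] A *m M))).
- by rewrite /subdiag big_set0 mul0mx addr0 det1.
- move=> {sep}X {}Y gap; apply: det_subdiagU.
    apply/pred0P=> x; apply/negP => /andP[xX xY].
    by have := gap _ _ xX xY; rewrite ltnNge leqnSn.
  (* Since y + 1 < x, the entry (x, y + 1) lies strictly below the diagonal. *)
  move=> x y xX yY; apply: upper_invmx; last exact: gap.
    by move=> i j ji; rewrite mxE leqNgt ji.
  by move=> i; rewrite mxE leqnn gt_eqF.
- exact: (@separated_gap m.+1 X Y sep).
Qed.
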